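(* Let $G$ be a finite group with a presentation $G=\langle F\mid R\rangle$, i.e. $F$ is a free group, $R$ is a normal subgroup of $F$ and $G\cong F/R$. Then there is a group isomorphism $$\mathcal{M}(G;\mathbb{Z}_2)\;\cong\;\frac{R\cap S(F)}{[F,R]R^2},$$ where $\mathcal{M}(G;\mathbb{Z}_2)$ is the unoriented Schur multiplier of $G$.
   Context: For a group $H$, $S(H)=\langle x^2: x\in H\rangle$ is the subgroup generated by all squares; $R^2$ denotes the subgroup generated by the squares of elements of $R$, and $[F,R]$ the subgroup generated by commutators $[f,r]$, $f\in F$, $r\in R$. Unoriented Schur multiplier. Let $G$ be a group. Put $[x,y]=xyx^{-1}y^{-1}$, $\{x,y\}=xyx^{-1}y$, $y^x=xyx^{-1}$. Let $(G,G)$ be the free group on the symbols $\langle x,y\rangle$, $(x,y)$ (for $x,y\in G$) and $(z)$ (for $z\in G$). On symbols, $\langle y,z\rangle^x:=\langle y^x,z^x\rangle$, $(y,z)^x:=(y^x,z^x)$, $(z)^x:=(z^x)$. Let $(G,G)\to S(G)$ be the homomorphism with $\langle x,y\rangle\mapsto[x,y]$, $(x,y)\mapsto\{x,y\}$, $(z)\mapsto z^2$, and let $K'$ be its kernel. Let $N'$ be the normal subgroup of $(G,G)$ generated by the following relations ($u\sim v$ meaning $uv^{-1}\in N'$), for all elements of $G$ and all $i,j\in\mathbb{Z}$: (1) $(x^i)(x^j)\sim(x^{i+j})$; (2) $(x,xy)\sim(x)(y)$; (3) $\langle x,y\rangle\sim(x)(x^{-1}y)(y^{-1})$; (4) $\langle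 xy,z\rangle\sim(y,z)^x(x,z^{-1})$; (5) $\langle y,z\rangle^x\sim\langle x,[y,z]\rangle\langle y,z\rangle$; (6) $(y,z)^x\sim\langle x,\{y,z\}\rangle(y,z)$; (7) $(y^x,z^x)^{-1}\sim(x,\{y,z\}^{-1})(y,z)$; (8) $(z)\langle x,y\rangle\sim\langle y,x\rangle^z(z[x,y])$; (9) $(b)\langle a_0,b_0\rangle\sim\langle a_0,b_0\rangle^{b^2}(b)$; (10) $\langle a_0,b_0\rangle(a)\sim(a)\langle a_0,b_0\rangle^{a^{-2}}$. The unoriented Schur multiplier is $\mathcal{M}(G;\mathbb{Z}_2):=K'/N'$. *)

(* Defs.v *)
From HB Require Import structures.
From mathcomp Require Import all_boot.
From mathcomp Require Import ssralg ssrint.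
From mathcomp Require Import boolp classical_sets.

Set Implicit Arguments.
Unset Strict Implicit.
Unset Printing Implicit Defensive.

Local Open Scope classical_set_scope.
Local Open Scope quotient_scope.
Local Open Scope group_scope.

(* The library's [groupType] (no finiteness), with subgroups as [groupClosed]
   predicates.  The commutator and conjugation of the library are
   [~ x, y] = x^-1 y^-1 x y and x ^ y = y^-1 x y; the ones used here are the
   left-handed ones below. *)

Definition lconj (T : groupType) (x y : T) : T := x * y * x^-1.
Definition lcomm (T : groupType) (x y : T) : T := x * y * x^-1 * y^-1.
Definition lbrace (T : groupType) (x y : T) : T := x * y * x^-1 * y.

Definition zexp (T : groupType) (x : T) (i : int) : T :=
  match i with Posz n => x ^+ n | Negz n => x ^- n.+1 end.

Definition isog_group (A B : groupType) : Prop :=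
  exists2 f : A -> B, {morph f : x y / x * y} & bijective f.

HB.mixin Record isConjClosed (T : groupType) (S : {pred T}) := {
  gpredLJ_subproof : forall x y, y \in S -> lconj x y \in S
}.

#[short(type="normalClosed")]
HB.structure Definition NormalClosed (T : groupType) :=
  {S of GroupClosed T S & isConjClosed T S}.

Lemma gpredLJ (T : groupType) (N : normalClosed T) (x y : T) :
  y \in N -> lconj x y \in N.
Proof. exact: gpredLJ_subproof. Qed.

Lemma gpredLJE (T : groupType) (N : normalClosed T) (x y : T) :
  (lconj x y \in N) = (y \in N).
Proof.
apply/idP/idP => [|/gpredLJ//]; move/(gpredLJ x^-1).
by rewrite /lconj invgK !mulgA mulVg mul1g mulgVK.
Qed.

Lemma normal_swap (T : groupType) (N : normalClosed T) (x y : T) :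
  (x * y \in N) = (y * x \in N).
Proof. by rewrite -(gpredLJE N x^-1) /lconj invgK mulKg. Qed.

Definition gensub (T : groupType) (A : set T) : {pred T} :=
  [pred x | `[< forall S : groupClosed T, A `<=` [set` S] -> x \in S >]].

Definition ngensub (T : groupType) (A : set T) : {pred T} :=
  [pred x | `[< forall S : normalClosed T, A `<=` [set` S] -> x \in S >]].

Lemma sub_gensub (T : groupType) (A : set T) x : A x -> x \in gensub A.
Proof. by move=> Ax; apply/asboolP => S; apply. Qed.

Lemma sub_ngensub (T : groupType) (A : set T) x : A x -> x \in ngensub A.
Proof. by move=> Ax; apply/asboolP => S; apply. Qed.

Fact gensub_mul (T : groupType) (A : set T) :
  {in gensub A &, forall u v, u * v \in gensub A}.
Proof.
move=> u v /asboolP hu /asboolP hv; apply/asboolP => S AS.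
by apply: gpredM; [exact: hu | exact: hv].
Qed.
Fact gensub1 (T : groupType) (A : set T) : 1 \in gensub A.
Proof. by apply/asboolP => S _; exact: gpred1. Qed.
Fact gensubV (T : groupType) (A : set T) :
  {in gensub A, forall u, u^-1 \in gensub A}.
Proof.
by move=> u /asboolP hu; apply/asboolP => S AS; rewrite gpredV; apply: hu.
Qed.
HB.instance Definition _ (T : groupType) (A : set T) :=
  isMulClosed.Build T (gensub A) (@gensub_mul T A).
HB.instance Definition _ (T : groupType) (A : set T) :=
  isMul1Closed.Build T (gensub A) (@gensub1 T A).
HB.instance Definition _ (T : groupType) (A : set T) :=
  isInvClosed.Build T (gensub A) (@gensubV T A).

Fact ngensub_mul (T : groupType) (A : set T) :
  {in ngensub A &, forall u v, u * v \in ngensub A}.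
Proof.
move=> u v /asboolP hu /asboolP hv; apply/asboolP => S AS.
by apply: gpredM; [exact: hu | exact: hv].
Qed.
Fact ngensub1 (T : groupType) (A : set T) : 1 \in ngensub A.
Proof. by apply/asboolP => S _; exact: gpred1. Qed.
Fact ngensubV (T : groupType) (A : set T) :
  {in ngensub A, forall u, u^-1 \in ngensub A}.
Proof.
by move=> u /asboolP hu; apply/asboolP => S AS; rewrite gpredV; apply: hu.
Qed.
Fact ngensubJ (T : groupType) (A : set T) x y :
  y \in ngensub A -> lconj x y \in ngensub A.
Proof. by move=> /asboolP hy; apply/asboolP => S AS; apply/gpredLJ/hy. Qed.
HB.instance Definition _ (T : groupType) (A : set T) :=
  isMulClosed.Build T (ngensub A) (@ngensub_mul T A).
HB.instance Definition _ (T : groupType) (A : set T) :=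
  isMul1Closed.Build T (ngensub A) (@ngensub1 T A).
HB.instance Definition _ (T : groupType) (A : set T) :=
  isInvClosed.Build T (ngensub A) (@ngensubV T A).
HB.instance Definition _ (T : groupType) (A : set T) :=
  isConjClosed.Build T (ngensub A) (@ngensubJ T A).

Definition conj_pred (T : groupType) (x : T) (S : {pred T}) : {pred T} :=
  [pred y | lconj x y \in S].

Section ConjPred.
Variables (T : groupType) (x : T) (S : groupClosed T).
Fact conj_pred_mul : {in conj_pred x S &, forall u v, u * v \in conj_pred x S}.
Proof.
move=> u v; rewrite !inE => hu hv; have := gpredM _ _ hu hv.
by rewrite /lconj !mulgA mulgVK.
Qed.
Fact conj_pred1 : 1 \in conj_pred x S.
Proof. by rewrite inE /lconj mulg1 mulgV gpred1. Qed.
Fact conj_predV : {in conj_pred x S, forall u, u^-1 \in conj_pred x S}.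
Proof.
by move=> u; rewrite !inE -gpredV; rewrite /lconj !invgM invgK mulgA.
Qed.
HB.instance Definition _ := isMulClosed.Build T (conj_pred x S) conj_pred_mul.
HB.instance Definition _ := isMul1Closed.Build T (conj_pred x S) conj_pred1.
HB.instance Definition _ := isInvClosed.Build T (conj_pred x S) conj_predV.
End ConjPred.

Lemma gensubJ (T : groupType) (A : set T) :
  (forall x y, A y -> lconj x y \in gensub A) ->
  forall x y, y \in gensub A -> lconj x y \in gensub A.
Proof.
move=> AJ x y /asboolP /(_ (conj_pred x (gensub A))); apply => z Az.
exact: AJ.
Qed.

(* S(H) for a subgroup H of T; thus H^2 is the same as S(H). *)
Definition sqsub (T : groupType) (H : {pred T}) : {pred T} :=
  gensub [set x * x | x in [set` H]].
HB.instance Definition _ (T : groupType) (H : {pred T}) :=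
  GroupClosed.copy (sqsub H) (gensub [set x * x | x in [set` H]]).

Lemma sub_sqsub (T : groupType) (H : {pred T}) x : x \in H -> x * x \in sqsub H.
Proof. by move=> xH; apply: sub_gensub; exists x. Qed.

Fact sqsubJ (T : groupType) (N : normalClosed T) x y :
  y \in sqsub N -> lconj x y \in sqsub N.
Proof.
apply: gensubJ => {y} {}x _ [y Ny <-]; apply: sub_gensub.
exists (lconj x y); first by apply: gpredLJ.
by rewrite /lconj !mulgA mulgVK.
Qed.
HB.instance Definition _ (T : groupType) (N : normalClosed T) :=
  isConjClosed.Build T (sqsub N) (@sqsubJ T N).

(* [T, H], generated by the commutators [t, h] with t in T, h in H *)
Definition commsub (T : groupType) (H : {pred T}) : {pred T} :=
  gensub [set z | exists t : T, exists2 h, h \in H & z = lcomm t h].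
HB.instance Definition _ (T : groupType) (H : {pred T}) :=
  GroupClosed.copy (commsub H)
    (gensub [set z | exists t : T, exists2 h, h \in H & z = lcomm t h]).

Fact commsubJ (T : groupType) (N : normalClosed T) x y :
  y \in commsub N -> lconj x y \in commsub N.
Proof.
apply: gensubJ => {y} {}x _ [t [h Nh ->]]; apply: sub_gensub.
exists (lconj x t), (lconj x h); first exact: gpredLJ.
by rewrite /lconj /lcomm !invgM !invgK !mulgA !mulgVK.
Qed.
HB.instance Definition _ (T : groupType) (N : normalClosed T) :=
  isConjClosed.Build T (commsub N) (@commsubJ T N).

Definition prodsub (T : groupType) (A B : {pred T}) : {pred T} :=
  [pred z | `[< exists a b, [/\ a \in A, b \in B & z = a * b] >]].

Section ProdSub.
Variables (T : groupType) (A B : normalClosed T).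
Fact prodsub_mul : {in prodsub A B &, forall u v, u * v \in prodsub A B}.
Proof.
move=> _ _ /asboolP [a [b [Aa Bb ->]]] /asboolP [c [d [Ac Bd ->]]].
apply/asboolP; exists (a * lconj b c), (b * d); split.
- by apply: gpredM => //; apply: gpredLJ.
- exact: gpredM.
- by rewrite /lconj !mulgA mulgVK.
Qed.
Fact prodsub1 : 1 \in prodsub A B.
Proof. by apply/asboolP; exists 1, 1; rewrite !gpred1 mulg1. Qed.
Fact prodsubV : {in prodsub A B, forall u, u^-1 \in prodsub A B}.
Proof.
move=> _ /asboolP [a [b [Aa Bb ->]]]; apply/asboolP.
exists (lconj b^-1 a^-1), b^-1; rewrite gpredLJE !gpredV; split=> //.
by rewrite /lconj invgK invgM mulgK.
Qed.
Fact prodsubJ x y : y \in prodsub A B -> lconj x y \in prodsub A B.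
Proof.
move=> /asboolP [a [b [Aa Bb ->]]]; apply/asboolP.
exists (lconj x a), (lconj x b); rewrite !gpredLJE; split=> //.
by rewrite /lconj !mulgA mulgVK.
Qed.
HB.instance Definition _ := isMulClosed.Build T (prodsub A B) prodsub_mul.
HB.instance Definition _ := isMul1Closed.Build T (prodsub A B) prodsub1.
HB.instance Definition _ := isInvClosed.Build T (prodsub A B) prodsubV.
HB.instance Definition _ := isConjClosed.Build T (prodsub A B) prodsubJ.
End ProdSub.

Definition capsub (T : groupType) (A B : {pred T}) : {pred T} :=
  [pred x | (x \in A) && (x \in B)].

Section CapSub.
Variables (T : groupType) (A B : groupClosed T).
Fact capsub_mul : {in capsub A B &, forall u v, u * v \in capsub A B}.
Proof.
by move=> u v /andP[au bu] /andP[av bv]; rewrite inE !gpredM.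
Qed.
Fact capsub1 : 1 \in capsub A B.
Proof. by rewrite inE !gpred1. Qed.
Fact capsubV : {in capsub A B, forall u, u^-1 \in capsub A B}.
Proof. by move=> u; rewrite !inE !gpredV. Qed.
HB.instance Definition _ := isMulClosed.Build T (capsub A B) capsub_mul.
HB.instance Definition _ := isMul1Closed.Build T (capsub A B) capsub1.
HB.instance Definition _ := isInvClosed.Build T (capsub A B) capsubV.
End CapSub.

Definition kersub (A B : groupType) (f : A -> B) : {pred A} :=
  [pred x | f x == 1].

(* Quotient of a group by a normal subgroup: classes for x^-1 y \in N *)

Section Quotient.
Variables (T : groupType) (N : normalClosed T).

Definition coset_rel : rel T := fun x y => x^-1 * y \in N.

Fact coset_rel_refl : reflexive coset_rel.
Proof. by move=> x; rewrite /coset_rel mulVg gpred1. Qed.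
Fact coset_rel_sym : symmetric coset_rel.
Proof. by move=> x y; rewrite /coset_rel -gpredV invgM invgK. Qed.
Fact coset_rel_trans : transitive coset_rel.
Proof.
by move=> y x z xy yz; have := gpredM _ _ xy yz; rewrite mulgA mulgK.
Qed.

Canonical coset_equiv :=
  EquivRel coset_rel coset_rel_refl coset_rel_sym coset_rel_trans.

Definition quotg := {eq_quot coset_equiv}.
HB.instance Definition _ := Choice.on quotg.
HB.instance Definition _ := EqQuotient.on quotg.

Lemma quotg_eqE (x y : T) : (\pi_quotg x = \pi_quotg y) <-> (x^-1 * y \in N).
Proof. by split=> [/eqmodP|h]; last apply/eqmodP. Qed.

Lemma quotgP (u : quotg) : exists x, u = \pi_quotg x.
Proof. by exists (repr u); rewrite reprK. Qed.

Definition quotg_mul (u v : quotg) : quotg := \pi_quotg (repr u * repr v).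
Definition quotg_inv (u : quotg) : quotg := \pi_quotg (repr u)^-1.

Lemma repr_coset x : x^-1 * repr (\pi_quotg x) \in N.
Proof. by apply/quotg_eqE; rewrite reprK. Qed.

Lemma quotg_mulE x y : quotg_mul (\pi_quotg x) (\pi_quotg y) = \pi_quotg (x * y).
Proof.
apply/esym/quotg_eqE; have := repr_coset x; have := repr_coset y.
set a := repr _; set b := repr _ => ya xb.
have -> : (x * y)^-1 * (b * a) = lconj y^-1 (x^-1 * b) * (y^-1 * a).
  by rewrite /lconj invgK invgM !mulgA mulgK.
by apply: gpredM => //; apply: gpredLJ.
Qed.

Lemma quotg_invE x : quotg_inv (\pi_quotg x) = \pi_quotg x^-1.
Proof.
apply/esym/quotg_eqE; have := repr_coset x; set a := repr _ => xa.
by rewrite invgK normal_swap -gpredV invgM invgK.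
Qed.

Fact quotg_mulA : associative quotg_mul.
Proof.
move=> u v w; have [x ->] := quotgP u; have [y ->] := quotgP v.
by have [z ->] := quotgP w; rewrite !quotg_mulE mulgA.
Qed.
Fact quotg_mul1 : left_id (\pi_quotg 1) quotg_mul.
Proof. by move=> u; have [x ->] := quotgP u; rewrite quotg_mulE mul1g. Qed.
Fact quotg_mul1r : right_id (\pi_quotg 1) quotg_mul.
Proof. by move=> u; have [x ->] := quotgP u; rewrite quotg_mulE mulg1. Qed.
Fact quotg_mulV : left_inverse (\pi_quotg 1) quotg_inv quotg_mul.
Proof. by move=> u; have [x ->] := quotgP u; rewrite quotg_invE quotg_mulE mulVg. Qed.
Fact quotg_mulVr : right_inverse (\pi_quotg 1) quotg_inv quotg_mul.
Proof. by move=> u; have [x ->] := quotgP u; rewrite quotg_invE quotg_mulE mulgV. Qed.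
HB.instance Definition _ := isGroup.Build quotg
  quotg_mulA quotg_mul1 quotg_mul1r quotg_mulV quotg_mulVr.

Lemma pi_quotgM : {morph \pi_quotg : x y / x * y}.
Proof. by move=> x y; rewrite -quotg_mulE. Qed.

End Quotient.

Section SubgroupType.
Variables (T : groupType) (H : groupClosed T).

Record subgrp := Subgrp { subgrp_val : T; _ : subgrp_val \in H }.
HB.instance Definition _ := [isSub for subgrp_val].
HB.instance Definition _ := [Choice of subgrp by <:].

Fact subgrp_closed : group_closed (H : {pred T}).
Proof. by split; [exact: gpred1 | exact: gpredF]. Qed.
HB.instance Definition _ :=
  SubChoice_isSubGroup.Build T (H : {pred T}) subgrp subgrp_closed.
End SubgroupType.

(* N as a normal subgroup of H, when N is contained in H (and H :&: N in
   general) *)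
Definition restrsub (T : groupType) (H : groupClosed T) (N : {pred T}) :
  {pred subgrp H} := [pred u | val u \in N].
Arguments restrsub {T} H N _ /.

Section RestrSub.
Variables (T : groupType) (H : groupClosed T) (N : normalClosed T).
Fact restrsub_mul :
  {in restrsub H N &, forall u v, u * v \in restrsub H N}.
Proof. by move=> u v; rewrite !inE valM; apply: gpredM. Qed.
Fact restrsub1 : 1 \in restrsub H N.
Proof. by rewrite inE val1 gpred1. Qed.
Fact restrsubV : {in restrsub H N, forall u, u^-1 \in restrsub H N}.
Proof. by move=> u; rewrite !inE gmulfV gpredV. Qed.
Fact restrsubJ x y : y \in restrsub H N -> lconj x y \in restrsub H N.
Proof. by rewrite !inE !valM gmulfV; apply: gpredLJ. Qed.
HB.instance Definition _ :=
  isMulClosed.Build (subgrp H) (restrsub H N) restrsub_mul.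
HB.instance Definition _ :=
  isMul1Closed.Build (subgrp H) (restrsub H N) restrsub1.
HB.instance Definition _ :=
  isInvClosed.Build (subgrp H) (restrsub H N) restrsubV.
HB.instance Definition _ :=
  isConjClosed.Build (subgrp H) (restrsub H N) restrsubJ.
End RestrSub.

(* H / N; used below only with N contained in H *)
Definition subquot (T : groupType) (H : groupClosed T) (N : normalClosed T)
  : groupType := quotg (restrsub H N).

(* Free groups: words in the letters x (coded (x, false)) and x^-1 (coded
   (x, true)), up to insertion and deletion of x x^-1 and x^-1 x *)

Section FreeGroup.
Variable X : choiceType.
Implicit Types u v w : seq (X * bool).

Definition flip_letter (a : X * bool) : X * bool := (a.1, ~~ a.2).

Inductive word_eq : seq (X * bool) -> seq (X * bool) -> Prop :=
| Word_refl u : word_eq u u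
| Word_sym u v : word_eq u v -> word_eq v u
| Word_trans u v w : word_eq u v -> word_eq v w -> word_eq u w
| Word_cancel u a v : word_eq (u ++ [:: a, flip_letter a & v]) (u ++ v).

Definition word_rel : rel (seq (X * bool)) := fun u v => `[< word_eq u v >].

Fact word_rel_refl : reflexive word_rel.
Proof. by move=> u; apply/asboolP; exact: Word_refl. Qed.
Fact word_rel_sym : symmetric word_rel.
Proof. by move=> u v; apply/asboolP/asboolP; exact: Word_sym. Qed.
Fact word_rel_trans : transitive word_rel.
Proof.
by move=> v u w /asboolP uv /asboolP vw; apply/asboolP; exact: Word_trans vw.
Qed.
Canonical word_equiv :=
  EquivRel word_rel word_rel_refl word_rel_sym word_rel_trans.

Definition freegrp := {eq_quot word_equiv}.
HB.instance Definition _ := Choice.on freegrp.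
HB.instance Definition _ := EqQuotient.on freegrp.

Lemma freegrp_eqE u v : (\pi_freegrp u = \pi_freegrp v) <-> word_eq u v.
Proof. by split=> [/eqmodP/asboolP|h]; last by apply/eqmodP/asboolP. Qed.

Lemma word_eq_catl w u v : word_eq u v -> word_eq (w ++ u) (w ++ v).
Proof.
elim=> [{}u|{}u {}v _|u1 u2 u3 _ h1 _ h2|{}u a {}v].
- exact: Word_refl.
- exact: Word_sym.
- exact: Word_trans h1 h2.
- by rewrite !catA; apply: Word_cancel.
Qed.

Lemma word_eq_catr w u v : word_eq u v -> word_eq (u ++ w) (v ++ w).
Proof.
elim=> [{}u|{}u {}v _|u1 u2 u3 _ h1 _ h2|{}u a {}v].
- exact: Word_refl.
- exact: Word_sym.
- exact: Word_trans h1 h2.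
- by rewrite -!catA; apply: Word_cancel.
Qed.

Definition word_inv u := rev (map flip_letter u).

Lemma flip_letterK : involutive flip_letter.
Proof. by case=> x b; rewrite /flip_letter negbK. Qed.

Lemma word_invK : involutive word_inv.
Proof.
move=> u; rewrite /word_inv map_rev revK -map_comp map_id_in// => a _.
exact: flip_letterK.
Qed.

Lemma word_inv_cat u v : word_inv (u ++ v) = word_inv v ++ word_inv u.
Proof. by rewrite /word_inv map_cat rev_cat. Qed.

Lemma word_eq_inv u v : word_eq u v -> word_eq (word_inv u) (word_inv v).
Proof.
elim=> [{}u|{}u {}v _|u1 u2 u3 _ h1 _ h2|{}u a {}v].
- exact: Word_refl.
- exact: Word_sym.
- exact: Word_trans h1 h2.
- rewrite !word_inv_cat.
  rewrite -[[:: a, _ & v]]/([:: a; flip_letter a] ++ v) word_inv_cat -catA.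
  by rewrite {2}/word_inv /= flip_letterK /=; apply: Word_cancel.
Qed.

Lemma word_mulV u : word_eq (u ++ word_inv u) [::].
Proof.
elim: u => [|a u IHu]; first exact: Word_refl.
have -> : (a :: u) ++ word_inv (a :: u) =
    [:: a] ++ (u ++ word_inv u) ++ [:: flip_letter a].
  by rewrite /word_inv /= rev_cons -cats1 !catA.
apply: (Word_trans (v := [:: a; flip_letter a])).
  apply: (word_eq_catl [:: a]).
  exact: (word_eq_catr [:: flip_letter a] IHu).
exact: (Word_cancel [::] a [::]).
Qed.

Lemma word_mulVr u : word_eq (word_inv u ++ u) [::].
Proof. by rewrite -{2}(word_invK u); apply: word_mulV. Qed.

Definition freegrp_mul (g h : freegrp) : freegrp :=
  \pi_freegrp (repr g ++ repr h).
Definition freegrp_inv (g : freegrp) : freegrp :=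
  \pi_freegrp (word_inv (repr g)).

Lemma freegrpP (g : freegrp) : exists u, g = \pi_freegrp u.
Proof. by exists (repr g); rewrite reprK. Qed.

Lemma repr_word u : word_eq (repr (\pi_freegrp u)) u.
Proof. by apply/freegrp_eqE; rewrite reprK. Qed.

Lemma freegrp_mulE u v :
  freegrp_mul (\pi_freegrp u) (\pi_freegrp v) = \pi_freegrp (u ++ v).
Proof.
apply/freegrp_eqE; apply: Word_trans (word_eq_catl u (repr_word v)).
exact/word_eq_catr/repr_word.
Qed.

Lemma freegrp_invE u :
  freegrp_inv (\pi_freegrp u) = \pi_freegrp (word_inv u).
Proof. exact/freegrp_eqE/word_eq_inv/repr_word. Qed.

Fact freegrp_mulA : associative freegrp_mul.
Proof.
move=> g h k; have [u ->] := freegrpP g; have [v ->] := freegrpP h.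
by have [w ->] := freegrpP k; rewrite !freegrp_mulE catA.
Qed.
Fact freegrp_mul1 : left_id (\pi_freegrp [::]) freegrp_mul.
Proof. by move=> g; have [u ->] := freegrpP g; rewrite freegrp_mulE. Qed.
Fact freegrp_mul1r : right_id (\pi_freegrp [::]) freegrp_mul.
Proof. by move=> g; have [u ->] := freegrpP g; rewrite freegrp_mulE cats0. Qed.
Fact freegrp_mulV : left_inverse (\pi_freegrp [::]) freegrp_inv freegrp_mul.
Proof.
move=> g; have [u ->] := freegrpP g; rewrite freegrp_invE freegrp_mulE.
exact/freegrp_eqE/word_mulVr.
Qed.
Fact freegrp_mulVr : right_inverse (\pi_freegrp [::]) freegrp_inv freegrp_mul.
Proof.
move=> g; have [u ->] := freegrpP g; rewrite freegrp_invE freegrp_mulE.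
exact/freegrp_eqE/word_mulV.
Qed.
HB.instance Definition _ := isGroup.Build freegrp
  freegrp_mulA freegrp_mul1 freegrp_mul1r freegrp_mulV freegrp_mulVr.

Definition fgen (x : X) : freegrp := \pi_freegrp [:: (x, false)].

Lemma freegrpM u v :
  \pi_freegrp u * \pi_freegrp v = \pi_freegrp (u ++ v).
Proof. exact: freegrp_mulE. Qed.

Variables (H : groupType) (f : X -> H).

Definition eval_letter (a : X * bool) : H := if a.2 then (f a.1)^-1 else f a.1.
Definition eval_word u : H := foldr (fun a h => eval_letter a * h) 1 u.
Definition free_lift (g : freegrp) : H := eval_word (repr g).

Lemma eval_word_cat u v : eval_word (u ++ v) = eval_word u * eval_word v.
Proof. by elim: u => [|a u /= ->]; rewrite ?mul1g ?mulgA. Qed.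

Lemma eval_word_eq u v : word_eq u v -> eval_word u = eval_word v.
Proof.
elim=> [//|//|u1 u2 u3 _ -> //|{}u [x b] {}v].
rewrite !eval_word_cat /=; congr (_ * _).
by case: b; rewrite /eval_letter /= ?mulKg ?mulVKg.
Qed.

Lemma free_liftE u : free_lift (\pi_freegrp u) = eval_word u.
Proof. exact/eval_word_eq/repr_word. Qed.

Lemma free_lift_gen x : free_lift (fgen x) = f x.
Proof. by rewrite free_liftE /= mulg1. Qed.

Fact free_liftM : {morph free_lift : g h / g * h}.
Proof.
move=> g h; have [u ->] := freegrpP g; have [v ->] := freegrpP h.
by rewrite freegrpM !free_liftE eval_word_cat.
Qed.
Fact free_lift1 : free_lift 1 = 1.
Proof. exact: free_liftE. Qed.
HB.instance Definition _ := isMultiplicative.Build freegrp H free_lift free_liftM.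
HB.instance Definition _ :=
  Multiplicative_isUMagmaMorphism.Build freegrp H free_lift free_lift1.

End FreeGroup.

Definition is_free (F : groupType) : Prop :=
  exists X : choiceType, isog_group (freegrp X) F.

Section Kernel.
Variables (A B : groupType) (f : UMagmaMorphism.type A B).
Fact kersub_mul : {in kersub f &, forall u v, u * v \in kersub f}.
Proof. by move=> u v /eqP hu /eqP hv; rewrite inE gmulfM hu hv mulg1. Qed.
Fact kersub1 : 1 \in kersub f.
Proof. by rewrite inE gmulf1. Qed.
Fact kersubV : {in kersub f, forall u, u^-1 \in kersub f}.
Proof. by move=> u /eqP hu; rewrite inE gmulfV hu invg1. Qed.
Fact kersubJ x y : y \in kersub f -> lconj x y \in kersub f.
Proof. by move=> /eqP hy; rewrite inE !gmulfM hy mulg1 gmulfV mulgV. Qed.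
HB.instance Definition _ := isMulClosed.Build A (kersub f) kersub_mul.
HB.instance Definition _ := isMul1Closed.Build A (kersub f) kersub1.
HB.instance Definition _ := isInvClosed.Build A (kersub f) kersubV.
HB.instance Definition _ := isConjClosed.Build A (kersub f) kersubJ.
End Kernel.

(* Ucomm x y is <x, y>, Ubrace x y is (x, y), Usq z is (z). *)
Inductive usymbol (G : Type) : Type :=
| Ucomm of G & G
| Ubrace of G & G
| Usq of G.

Section SymbolChoice.
Variable G : choiceType.
Definition usymbol_code (s : usymbol G) : (G * G + G * G) + G :=
  match s with
  | Ucomm x y => inl (inl (x, y))
  | Ubrace x y => inl (inr (x, y))
  | Usq z => inr z
  end.
Definition usymbol_decode (c : (G * G + G * G) + G) : usymbol G :=
  match c with
  | inl (inl (x, y)) => Ucomm x y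
  | inl (inr (x, y)) => Ubrace x y
  | inr z => Usq z
  end.
Fact usymbol_codeK : cancel usymbol_code usymbol_decode.
Proof. by case. Qed.
HB.instance Definition _ := Equality.copy (usymbol G) (can_type usymbol_codeK).
HB.instance Definition _ := Choice.copy (usymbol G) (can_type usymbol_codeK).
End SymbolChoice.

Section UnorientedSchur.
Variable G : groupType.
Implicit Types (x y z a b : G) (i j : int).

Definition usymbol_conj x (s : usymbol G) : usymbol G :=
  match s with
  | Ucomm y z => Ucomm (lconj x y) (lconj x z)
  | Ubrace y z => Ubrace (lconj x y) (lconj x z)
  | Usq z => Usq (lconj x z)
  end.

Definition usymbol_val (s : usymbol G) : G :=
  match s with
  | Ucomm x y => lcomm x y
  | Ubrace x y => lbrace x y
  | Usq z => z ^+ 2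
  end.

(* (G, G) *)
Definition ugroup : groupType := freegrp (usymbol G).

(* uJ x s is s^x, the action being on symbols and not in the group (G, G). *)
Definition uC x y : ugroup := fgen (Ucomm x y).
Definition uB x y : ugroup := fgen (Ubrace x y).
Definition uQ z : ugroup := fgen (Usq z).
Definition uJ x (s : usymbol G) : ugroup := fgen (usymbol_conj x s).

Inductive urelation : ugroup -> ugroup -> Prop :=
| Urel1 x i j : urelation (uQ (zexp x i) * uQ (zexp x j)) (uQ (zexp x (i + j)%R))
| Urel2 x y : urelation (uB x (x * y)) (uQ x * uQ y)
| Urel3 x y : urelation (uC x y) (uQ x * uQ (x^-1 * y) * uQ y^-1)
| Urel4 x y z : urelation (uC (x * y) z) (uJ x (Ubrace y z) * uB x z^-1)
| Urel5 x y z : urelation (uJ x (Ucomm y z)) (uC x (lcomm y z) * uC y z)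
| Urel6 x y z : urelation (uJ x (Ubrace y z)) (uC x (lbrace y z) * uB y z)
| Urel7 x y z : urelation (uB (lconj x y) (lconj x z))^-1
                          (uB x (lbrace y z)^-1 * uB y z)
| Urel8 x y z : urelation (uQ z * uC x y)
                          (uJ z (Ucomm y x) * uQ (z * lcomm x y))
| Urel9 b x y : urelation (uQ b * uC x y) (uJ (b ^+ 2) (Ucomm x y) * uQ b)
| Urel10 a x y : urelation (uC x y * uQ a) (uQ a * uJ (a ^- 2) (Ucomm x y)).

(* (G, G) -> S(G), with codomain G: the values lie in S(G) by [ueval_sqsub]
   below, and the kernel K' is the same. *)
Definition ueval : ugroup -> G := free_lift usymbol_val.
HB.instance Definition _ := UMagmaMorphism.on ueval.

Definition ukernel : {pred ugroup} := kersub ueval.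
HB.instance Definition _ := NormalClosed.on ukernel.

(* N' *)
Definition urelators : {pred ugroup} :=
  ngensub [set w | exists u v, urelation u v /\ w = u * v^-1].
HB.instance Definition _ := NormalClosed.on urelators.

Definition unoriented_schur : groupType := subquot ukernel urelators.
End UnorientedSchur.

Arguments ukernel : clear implicits.
Arguments urelators : clear implicits.

(* Consistency: N' is contained in K', and [F, R] R^2 in R :&: S(F), so that
   [subquot] is the usual quotient in both cases. *)

Section Inclusions.

Lemma zexpD (T : groupType) (x : T) i j : zexp x (i + j)%R = zexp x i * zexp x j.
Proof.
have e1 (k : int) : zexp x (k + 1)%R = zexp x k * x.
  case: k => [n|[|n]]; first by rewrite -PoszD addn1 /= expgSr.
    by rewrite /= mulVg.
  have -> : (Negz n.+1 + 1)%R = Negz n.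
    by rewrite !NegzE (intS n.+1) GRing.opprD GRing.addrAC GRing.addNr
      GRing.add0r.
  by rewrite /= (expgS x n.+1) invgM mulgVK.
have eN (k : int) : zexp x (k - 1)%R = zexp x k * x^-1.
  by apply: (mulIg x); rewrite -e1 GRing.subrK mulgVK.
elim/int_ind: j => [|n IH|n IH]; first by rewrite GRing.addr0 /= mulg1.
  by rewrite -addn1 PoszD GRing.addrA !e1 IH mulgA.
by rewrite -addn1 PoszD GRing.opprD GRing.addrA !eN IH mulgA.
Qed.

Lemma lcomm_sq (T : groupType) (x y : T) :
  lcomm x y = x * x * ((x^-1 * y) * (x^-1 * y)) * (y^-1 * y^-1).
Proof. by rewrite /lcomm !mulgA !mulgK. Qed.

Lemma lcomm_sqsub (T : groupType) (x y : T) : lcomm x y \in sqsub (@predT T).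
Proof.
rewrite lcomm_sq; apply: gpredM; last exact: sub_sqsub.
by apply: gpredM; apply: sub_sqsub.
Qed.

Lemma lbrace_sqsub (T : groupType) (x y : T) : lbrace x y \in sqsub (@predT T).
Proof.
have -> : lbrace x y = x * x * ((x^-1 * y) * (x^-1 * y)).
  by rewrite /lbrace !mulgA mulgK.
by apply: gpredM; apply: sub_sqsub.
Qed.

Lemma ueval_sqsub (G : groupType) (g : ugroup G) :
  ueval g \in sqsub (@predT G).
Proof.
have [u ->] := freegrpP g; rewrite /ueval free_liftE.
elim: u => [|[s b] u IHu] /=; first exact: gpred1.
have hs : usymbol_val s \in sqsub (@predT G).
  case: s => [x y|x y|z]; [exact: lcomm_sqsub | exact: lbrace_sqsub |].
  exact: sub_sqsub.
by apply: gpredM => //; case: b; rewrite /eval_letter /= ?gpredV.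
Qed.

Lemma urelators_sub (G : groupType) : {subset urelators G <= ukernel G}.
Proof.
move=> w /asboolP; apply=> {w} _ [u [v [uv ->]]] /=.
have EM : {morph @ueval G : u v / u * v} by exact: free_liftM.
have EV : {morph @ueval G : u / u^-1} by exact: gmulfV.
rewrite inE EM EV; apply/eqP; apply: (mulIg (ueval v)); rewrite mulgVK mul1g.
have E (s : usymbol G) : ueval (fgen s) = usymbol_val s by exact: free_lift_gen.
case: uv => [x i j|x y|x y|x y z|x y z|x y z|x y z|x y z|b x y|a x y];
  rewrite ?EM ?EV /uC /uB /uQ /uJ ?E /= ?expg2.
- set a := zexp x i; set b := zexp x j.
  have ab : commute a b by rewrite /commute -!zexpD GRing.addrC.
  by rewrite zexpD -/a -/b !mulgA -(mulgA a b a) -ab !mulgA.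
all: rewrite /lcomm /lbrace /lconj ?expg2 ?invgM ?invgK ?mulgA.
all: by rewrite ?(mulgVK, mulgK, mulgV, mulVg, mul1g).
Qed.

Lemma hopf_sub (F : groupType) (R : normalClosed F) :
  {subset prodsub (commsub R) (sqsub R) <= capsub R (sqsub predT)}.
Proof.
move=> _ /asboolP [a [b [/asboolP ha /asboolP hb ->]]].
apply: gpredM; [apply: ha => _ [t [r Rr ->]] | apply: hb => _ [r /= Rr <-]].
  rewrite /= inE lcomm_sqsub andbT /lcomm -/(lconj t r).
  by apply: gpredM; rewrite ?gpredV//; apply: gpredLJ.
by rewrite /= inE gpredM //; apply: sub_sqsub.
Qed.

End Inclusions.

(* Main.v *)
(** Write [U = (G, G) / N'].  The relations say that [U] is generated by the
    squares [(z)] alone, since [(x, y) = (x)(x^-1 y)] and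
    [<x, y> = (x)(x^-1 y)(y^-1)], and they imply that [U -> G] behaves like a
    crossed module: [[u, v] = <du, dv>] and [u^2 = (du)], [d : U -> G] being
    the evaluation.  One can therefore adjoin elements of [G] one at a time to
    [U], each step being an extension by a cyclic group of order 2, so as to
    keep [e^2 = (p e)] for all [e], until one gets a group [E] containing
    [U] and a surjection [p : E -> G] extending [d].

    If [G = F / R] with [F] free, then [F -> G] lifts to [F -> E].  As an
    element of [R] goes to some [e] with [p e = 1], hence with [e^2 = (1) = 1]
    and [[f, e] = <p f, 1> = 1], this lift kills [[F, R] R^2], and it sends
    [f^2] to [(f R)].  Conversely [F / ([F, R] R^2)] is an extension of [G] in
    which the square of a lift of [z] depends only on [z], so [(z) |-> z^2]
    defines [U -> F / ([F, R] R^2)].  The two maps are inverse to each other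
    between [U] and [S(F) / ([F, R] R^2)], compatibly with the maps to [G]. *)

Require Import Defs.
From HB Require Import structures.
From mathcomp Require Import all_boot fingroup.
From mathcomp Require Import generic_quotient ssralg ssrint.
From mathcomp Require Import boolp classical_sets.

Set Implicit Arguments.
Unset Strict Implicit.
Unset Printing Implicit Defensive.

Local Open Scope classical_set_scope.
Local Open Scope quotient_scope.
Local Open Scope group_scope.

(** * Morphisms, left conjugation and comparison of subquotients *)

Section Morphisms.
Variables (A B : groupType) (f : A -> B).
Hypothesis fM : {morph f : x y / x * y}.

Lemma morph1 : f 1 = 1.
Proof. by apply: (mulgI (f 1)); rewrite -fM !mulg1. Qed.

Lemma morphV x : f x^-1 = (f x)^-1.
Proof. by apply: (mulgI (f x)); rewrite -fM !mulgV morph1. Qed.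

Lemma morph_lconj x y : f (lconj x y) = lconj (f x) (f y).
Proof. by rewrite /lconj !fM morphV. Qed.

Lemma morph_lcomm x y : f (lcomm x y) = lcomm (f x) (f y).
Proof. by rewrite /lcomm !fM !morphV. Qed.

Lemma morph_lbrace x y : f (lbrace x y) = lbrace (f x) (f y).
Proof. by rewrite /lbrace !fM morphV. Qed.

Lemma morph_zexp x i : f (zexp x i) = zexp (f x) i.
Proof.
have fX n : f (x ^+ n) = f x ^+ n.
  by elim: n => [|n IHn]; rewrite ?morph1 // !expgS fM IHn.
by case: i => n; rewrite /= ?morphV fX.
Qed.
End Morphisms.

Section LeftConjugation.
Variable T : groupType.
Implicit Types x y z : T.

Lemma lconjM x : {morph lconj x : y z / y * z}.
Proof. by move=> y z; rewrite /lconj !mulgA mulgVK. Qed.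

Lemma lconjJ x y z : lconj (x * y) z = lconj x (lconj y z).
Proof. by rewrite /lconj invgM !mulgA. Qed.

Lemma lconj1 x : lconj 1 x = x.
Proof. by rewrite /lconj invg1 mulg1 mul1g. Qed.

Lemma lconjg1 x : lconj x 1 = 1.
Proof. by rewrite /lconj mulg1 mulgV. Qed.

Lemma lconj_id x : lconj x x = x.
Proof. by rewrite /lconj mulgK. Qed.

Lemma lbrace_sq x y : lbrace x y = x * x * ((x^-1 * y) * (x^-1 * y)).
Proof. by rewrite /lbrace !mulgA mulgK. Qed.

Lemma lconj_lcomm x y : lconj x y = lcomm x y * y.
Proof. by rewrite /lcomm mulgVK. Qed.

Lemma lconj_mulg x y : lconj x y * x = x * y.
Proof. by rewrite /lconj mulgVK. Qed.
End LeftConjugation.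

Lemma gensub_ind (T : groupType) (A : set T) (P : T -> Prop) :
  P 1 -> (forall x y, P x -> P y -> P (x * y)) -> (forall x, P x -> P x^-1) ->
  (forall x, A x -> P x) -> forall x, x \in gensub A -> P x.
Proof.
move=> P1 PM PV PA x; pose S : {pred T} := [pred y | `[< P y >]].
have SM : {in S &, forall u v, u * v \in S}.
  by move=> u v /asboolP Pu /asboolP Pv; apply/asboolP/PM.
have S1 : 1 \in S by apply/asboolP.
have SV : {in S, forall u, u^-1 \in S}.
  by move=> u /asboolP Pu; apply/asboolP/PV.
pose SG : groupClosed T := HB.pack S (isMulClosed.Build T S SM)
  (isMul1Closed.Build T S S1) (isInvClosed.Build T S SV).
by move=> /asboolP /(_ SG) h; apply/asboolP/h => y /PA Py; apply/asboolP.
Qed.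

Lemma fgenV (X : choiceType) (x : X) :
  \pi_(freegrp X) [:: (x, true)] = (fgen x)^-1.
Proof. exact: (esym (freegrp_invE [:: (x, false)])). Qed.

Lemma free_hom_eq (X : choiceType) (H : groupType) (f g : freegrp X -> H) :
  {morph f : x y / x * y} -> {morph g : x y / x * y} ->
  (forall x, f (fgen x) = g (fgen x)) -> f =1 g.
Proof.
move=> fM gM fg w; have [u ->] := freegrpP w.
elim: u => [|[x b] u IHu]; first by rewrite (morph1 fM) (morph1 gM).
rewrite -cat1s -freegrpM fM gM IHu; congr (_ * _); case: b; last exact: fg.
by rewrite fgenV (morphV fM) (morphV gM) fg.
Qed.

(** The two directions of the equivalence on [K] make the induced map well defined and injective, so
    [h] can be a morphism of the ambient groups that reaches [L] only modulo [M]. *)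
Lemma subquot_isog (A B : groupType) (K : groupClosed A) (N : normalClosed A)
    (L : groupClosed B) (M : normalClosed B) (h : A -> B) :
  {morph h : x y / x * y} -> {in K, forall w, h w \in L} ->
  {in K, forall w, (w \in N) = (h w \in M)} ->
  {in L, forall l, exists2 w, w \in K & (h w)^-1 * l \in M} ->
  isog_group (subquot K N) (subquot L M).
Proof.
move=> hM hL hN hsurj.
pose h' (u : subgrp K) : subgrp L := Subgrp (hL _ (valP u)).
pose f (u : subquot K N) : subquot L M :=
  \pi_(quotg (restrsub L M)) (h' (repr u)).
have fE u :
    f (\pi_(quotg (restrsub K N)) u) = \pi_(quotg (restrsub L M)) (h' u).
  apply/quotg_eqE; have := repr_coset (restrsub K N) u.
  set v := repr _; rewrite !inE !valM !gmulfV /= => uv.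
  have /= := valP v; have /= := valP u => Ku Kv.
  rewrite -(morphV hM) -hM -hN; last by rewrite gpredM ?gpredV.
  by rewrite normal_swap -gpredV invgM invgK normal_swap.
exists f.
  move=> u v; have [x ->] := quotgP u; have [y ->] := quotgP v.
  rewrite -pi_quotgM !fE -pi_quotgM; congr (\pi _); apply: val_inj.
  by rewrite valM /= -hM -valM.
have finj : injective f.
  move=> u v; have [x ->] := quotgP u; have [y ->] := quotgP v.
  rewrite !fE => /quotg_eqE; rewrite !inE !valM !gmulfV /= => xy.
  apply/quotg_eqE; rewrite !inE !valM !gmulfV /= hN ?hM ?(morphV hM) //.
  by rewrite gpredM ?gpredV; [|exact: (valP x)|exact: (valP y)].
have fsurj v : exists u, f u == v.
  have [y ->] := quotgP v; have [w Kw wy] := hsurj _ (valP y).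
  exists (\pi_(quotg (restrsub K N)) (Subgrp Kw)); rewrite fE.
  apply/eqP/quotg_eqE.
  by rewrite !inE !valM !gmulfV.
exists (fun v => xchoose (fsurj v)); last first.
  by move=> v; apply/eqP/(xchooseP (fsurj v)).
by move=> u; apply: finj; apply/eqP/(xchooseP (fsurj (f u))).
Qed.

(** * The group $U=(G,G)/N'$, its crossed-module identities and its overgroups *)

Section USchurCover.
Variable G : groupType.
Implicit Types x y z a b : G.

Definition ucover : groupType := quotg (urelators G).
Implicit Types u v w : ucover.

Local Notation pi := (\pi_(quotg (urelators G))).

Definition uval u : G := ueval (repr u).
Definition usq z : ucover := pi (uQ z).
Definition ucm x y : ucover := pi (uC x y).

Lemma uevalM : {morph @ueval G : u v / u * v}.
Proof. exact: free_liftM. Qed.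

Lemma uval_pi (w : ugroup G) : uval (pi w) = ueval w.
Proof.
have /urelators_sub := repr_coset (urelators G) w; rewrite inE uevalM.
rewrite (morphV uevalM) => /eqP h.
by apply: (mulgI (ueval w)^-1); rewrite h mulVg.
Qed.

Lemma uvalM : {morph uval : u v / u * v}.
Proof.
move=> u v; have [x ->] := quotgP u; have [y ->] := quotgP v.
by rewrite -pi_quotgM !uval_pi uevalM.
Qed.

Lemma uval_sq z : uval (usq z) = z * z.
Proof. by rewrite uval_pi /ueval free_lift_gen /= expg2. Qed.

Lemma uval_cm x y : uval (ucm x y) = lcomm x y.
Proof. by rewrite uval_pi /ueval free_lift_gen. Qed.

Lemma pi_urelation (u v : ugroup G) : urelation u v -> pi u = pi v.
Proof.
move=> uv; have uvN : u * v^-1 \in urelators G.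
  by apply: sub_ngensub; exists u, v.
by apply/esym/quotg_eqE; rewrite normal_swap.
Qed.

Let piM := @pi_quotgM _ (urelators G).

Lemma usq1 : usq 1 = 1.
Proof.
have := pi_urelation (Urel1 1 0%Z 0%Z); rewrite piM /= expg0 => h.
by apply: (mulgI (usq 1)); rewrite mulg1 /usq h.
Qed.

Lemma usq_exp2 x : usq (x * x) = usq x * usq x.
Proof.
by have := pi_urelation (Urel1 x 1%Z 1%Z); rewrite piM /= !expg1 expg2.
Qed.

Lemma usqV x : usq x^-1 = (usq x)^-1.
Proof.
have := pi_urelation (Urel1 x 1%Z (-1)%Z); rewrite piM /= expg0 !expg1.
rewrite -/(usq _) -/(usq _) -/(usq 1) usq1 => h.
by apply: (mulgI (usq x)); rewrite h mulgV.
Qed.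

Lemma pi_uB x y : pi (uB x y) = usq x * usq (x^-1 * y).
Proof.
by have := pi_urelation (Urel2 x (x^-1 * y)); rewrite piM mulKVg.
Qed.

Lemma ucmE x y : ucm x y = usq x * usq (x^-1 * y) * usq y^-1.
Proof. by have := pi_urelation (Urel3 x y); rewrite !piM. Qed.

Lemma ucmg1 x : ucm x 1 = 1.
Proof. by rewrite ucmE mulg1 !usqV usq1 invg1 mulg1 mulgV. Qed.

Lemma ucm1g x : ucm 1 x = 1.
Proof. by rewrite ucmE invg1 mul1g usqV usq1 mul1g mulgV. Qed.

Lemma ucmxx x : ucm x x = 1.
Proof. by rewrite ucmE mulVg usq1 mulg1 usqV mulgV. Qed.

Lemma ucm_exp2 x : ucm x (x * x) = 1.
Proof. by rewrite ucmE mulKg usqV usq_exp2 mulgV. Qed.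

Lemma ucmV x y : (ucm x y)^-1 = ucm y x.
Proof. by rewrite !ucmE !invgM -!usqV !invgM !invgK mulgA. Qed.

(** Relation (4), rewritten by (2) and (3), has a last factor independent of [y]; the case [y = 1]
    identifies it as [ucm x z]. *)
Lemma ucmMl x y z : ucm (x * y) z = ucm (lconj x y) (lconj x z) * ucm x z.
Proof.
have rel4 t : ucm (x * t) z = ucm (lconj x t) (lconj x z) *
    (usq (lconj x z) * (usq x * usq (x^-1 * z^-1))).
  have := pi_urelation (Urel4 x t z); rewrite piM /uJ /= -/(uB _ _) !pi_uB.
  by rewrite -/(ucm _ _) => ->; rewrite (ucmE (lconj x t)) usqV !mulgA mulgVK.
by rewrite rel4; have := rel4 1; rewrite mulg1 lconjg1 ucm1g mul1g => <-.
Qed.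

Lemma ucmMr x y z : ucm x (y * z) = ucm x y * ucm (lconj y x) (lconj y z).
Proof. by rewrite -ucmV ucmMl invgM !ucmV. Qed.

Lemma ucmJ x y z :
  ucm (lconj x y) (lconj x z) = ucm x (lcomm y z) * ucm y z.
Proof. by have := pi_urelation (Urel5 x y z); rewrite piM. Qed.

(** This is relation (6) for the symbol $(1,z)$, since $\{1,z\}=z^2$ and $(1,z)\sim(z)$. *)
Lemma usqJ x z : usq (lconj x z) = ucm x (z * z) * usq z.
Proof.
have := pi_urelation (Urel6 x 1 z); rewrite piM /uJ /= -/(uB _ _) !pi_uB.
by rewrite lconjg1 usq1 !invg1 !mul1g /lbrace invg1 mulg1 mul1g.
Qed.

(* Expand [ucm (x * y) (x * y) = 1] by [ucmMl]. *)
Lemma usqM x y : usq (x * y) = ucm (lconj x y) x * usq x * usq y.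
Proof.
have := ucmxx (x * y); rewrite ucmMl lconjM lconj_id ucmMr ucmxx mulg1.
rewrite (ucmE x) mulKg usqV => h; apply: (mulIg (usq (x * y))^-1).
by rewrite mulgV -h !mulgA.
Qed.

(** Every symbol is a product of squares by relations (2) and (3), and [usqV] turns their inverses
    into squares again. *)
Lemma ucover_ind (P : ucover -> Prop) :
  P 1 -> (forall z u, P u -> P (usq z * u)) -> forall u, P u.
Proof.
move=> P1 PM u; have [w ->] := quotgP u; have [{w}s ->] := freegrpP w.
elim: s => [//|[s e] t]; set Pt := P _ => IHt.
rewrite -cat1s -freegrpM piM.
suff hs v : P v -> P (pi (\pi [:: (s, e)]) * v) by exact: hs.
have Q t' : exists l : seq G, pi (fgen t') = \prod_(z <- l) usq z.
  case: t' => [x y|x y|z].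
  - exists [:: x; x^-1 * y; y^-1].
    by rewrite !big_cons big_nil mulg1 mulgA -ucmE.
  - by exists [:: x; x^-1 * y]; rewrite !big_cons big_nil mulg1 -pi_uB.
  - by exists [:: z]; rewrite big_seq1.
have PL l v' : P v' -> P (\prod_(z <- l) usq z * v').
  elim: l => [|z l IHl] Pv'; rewrite ?big_nil ?mul1g //.
  by rewrite big_cons -mulgA; apply/PM/IHl.
have [l el] := Q s; case: e => Pv; last by rewrite -/(fgen s) el; apply: PL.
rewrite fgenV (morphV piM) el.
have -> : (\prod_(z <- l) usq z)^-1 =
    \prod_(z <- [seq z^-1 | z <- rev l]) usq z.
  elim: l {el} => [|z l IHl]; first by rewrite !big_nil invg1.
  by rewrite big_cons invgM IHl rev_cons map_rcons -cats1 big_cat big_seq1 usqV.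
exact: PL.
Qed.

(* Both [usq (z * y)] and [usq (lconj z y * z)] are expanded by [usqM]. *)
Lemma lconj_usq u y : lconj u (usq y) = usq (lconj (uval u) y).
Proof.
elim/ucover_ind: u y => [|z u IHu] y; first by rewrite (morph1 uvalM) !lconj1.
rewrite lconjJ IHu uvalM lconjJ uval_sq; move: (lconj _ y) => {}y.
rewrite [in RHS]lconjJ usqJ; set w := lconj z y.
have e : usq z * usq y = ucm z w * ucm (lconj w z) w * usq w * usq z.
  apply: (mulgI (ucm w z)); rewrite !mulgA -(ucmV z w) mulVg mul1g.
  by rewrite ucmV -usqM -usqM lconj_mulg.
by rewrite {1}/lconj e mulgK ucmMr lconj_id.
Qed.

Lemma lconj_ucm u x y :
  lconj u (ucm x y) = ucm (lconj (uval u) x) (lconj (uval u) y).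
Proof.
rewrite !ucmE !(lconjM u) !lconj_usq (morphV (lconjM _)) lconjM.
by rewrite (morphV (lconjM _)).
Qed.

(** The Peiffer law of the crossed module. As a formula for [lconj u v] it goes by induction on [v]:
    [usqJ] treats a square and [ucmMr] a product. *)
Lemma ucover_peiffer u v : lcomm u v = ucm (uval u) (uval v).
Proof.
suff h : lconj u v = ucm (uval u) (uval v) * v.
  by rewrite /lcomm -/(lconj u v) h mulgK.
elim/ucover_ind: v => [|z v IHv].
  by rewrite lconjg1 (morph1 uvalM) ucmg1 mulg1.
rewrite lconjM lconj_usq usqJ IHv uvalM [ucm _ (_ * uval v)]ucmMr.
by rewrite -lconj_ucm uval_sq /lconj !mulgA mulgVK.
Qed.

Lemma ucover_sq u : u * u = usq (uval u).
Proof.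
elim/ucover_ind: u => [|z u IHu]; first by rewrite (morph1 uvalM) usq1 mulg1.
(* With $a$ = [usq z], the first factor given by [usqM] is $a[a,u]^{-1}a^{-1}$, which turns $a^2u^2$
   into $(au)^2$. *)
rewrite uvalM usqM uval_sq usq_exp2 -IHu -uval_sq.
rewrite -[ucm _ _]ucmV -{1}[uval (usq z)]lconj_id -lconj_ucm -ucover_peiffer.
by rewrite /lconj /lcomm !invgM !invgK !mulgA !(mulgK, mulgVK).
Qed.

(** The invariant kept while elements are adjoined. Surjectivity of [p] is not part of it, being
    reached only at the end. *)
Record square_lift (E : groupType) (p : E -> G) (i : ucover -> E) : Prop := {
  sqliftM : {morph p : e f / e * f};
  sqlift_injM : {morph i : u v / u * v};
  sqlift_inj : injective i;
  sqlift_val : forall u, p (i u) = uval u;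
  sqlift_sq : forall e, e * e = i (usq (p e)) }.

Lemma ucover_square_lift : square_lift uval id.
Proof. by split=> //; [exact: uvalM | exact: ucover_sq]. Qed.

(** A commutator is a product of three squares, which [sqlift_sq] evaluates in $U$; relation (3)
    reassembles them. *)
Lemma sqlift_comm (E : groupType) (p : E -> G) (i : ucover -> E) :
  square_lift p i -> forall e f, lcomm e f = i (ucm (p e) (p f)).
Proof.
move=> [pM iM _ _ sq] e f.
by rewrite lcomm_sq !sq ucmE !iM pM !(morphV pM).
Qed.

(** Conjugation is multiplication by a commutator, so [sqlift_comm] reduces the claim to relation
    (5). *)
Lemma sqlift_lconj (E : groupType) (p : E -> G) (i : ucover -> E) :
  square_lift p i -> forall e x y,
  lconj e (i (ucm x y)) = i (ucm (lconj (p e) x) (lconj (p e) y)).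
Proof.
move=> L e x y; rewrite lconj_lcomm (sqlift_comm L) (sqlift_val L) uval_cm.
by rewrite -(sqlift_injM L) -ucmJ.
Qed.

End USchurCover.

Arguments ucover : clear implicits.

(** * Adjoining elements of $G$ by extensions of degree 2 *)

Section CyclicExtension.
Variables (E : groupType) (alpha : E -> E) (m : E).

(** Compatibility conditions for a new element $t$: it commutes with its square [m], and conjugating
    twice by $t$ is conjugating by [m]. *)
Record ext2_data : Prop := {
  ext2M : {morph alpha : x y / x * y};
  ext2_fix : alpha m = m;
  ext2_sq : forall x, alpha (alpha x) = lconj m x }.

(** The proof is an argument of the type so that the group instance can recover it. *)
Definition ext2 (_ : ext2_data) : Type := (E * bool)%type.

Variable D : ext2_data.
HB.instance Definition _ := Choice.copy (ext2 D) (E * bool)%type.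
Implicit Types u v w : ext2 D.

Let aM := ext2M D.

(* [(e, b)] stands for [e * t ^+ b] with [t] acting as [alpha] and
   [t ^+ 2 = m]. *)
Definition ext2_mul u v : ext2 D :=
  (u.1 * (if u.2 then alpha v.1 else v.1) * (if u.2 && v.2 then m else 1),
   u.2 (+) v.2).
Definition ext2_one : ext2 D := (1, false).
Definition ext2_inv u : ext2 D :=
  (if u.2 then m^-1 * (alpha u.1)^-1 else u.1^-1, u.2).

Fact ext2_mulA : associative ext2_mul.
Proof.
move=> [x a] [y b] [z c]; rewrite /ext2_mul /= addbA; congr (_, _).
by case: a b c => [] [] []; rewrite /= ?mulg1 ?aM ?(ext2_fix D) ?(ext2_sq D);
  rewrite /lconj ?mulgA ?mulgVK.
Qed.
Fact ext2_mul1g : left_id ext2_one ext2_mul.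
Proof. by case=> x b; rewrite /ext2_mul /= mul1g mulg1. Qed.
Fact ext2_mulg1 : right_id ext2_one ext2_mul.
Proof.
by case=> x b; rewrite /ext2_mul /= andbF addbF (morph1 aM) if_same !mulg1.
Qed.
Fact ext2_mulVg : left_inverse ext2_one ext2_inv ext2_mul.
Proof.
by case=> x []; rewrite /ext2_mul /ext2_inv /= ?mulgVK mulVg ?mulg1.
Qed.
Fact ext2_mulgV : right_inverse ext2_one ext2_inv ext2_mul.
Proof.
case=> x []; rewrite /ext2_mul /ext2_inv /= ?mulg1 ?mulgV //.
rewrite aM !(morphV aM) (ext2_fix D) (ext2_sq D) /lconj !invgM !invgK.
by rewrite !mulgA !(mulgVK, mulgV, mulgK).
Qed.
HB.instance Definition _ := isGroup.Build (ext2 D)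
  ext2_mulA ext2_mul1g ext2_mulg1 ext2_mulVg ext2_mulgV.

Lemma ext2_mulE u v : u * v = ext2_mul u v.
Proof. by []. Qed.
End CyclicExtension.

Section AdjoinElement.
Variables (G E : groupType) (p : E -> G) (i : ucover G -> E) (x : G).
Hypothesis L : square_lift p i.

Let pM := sqliftM L.
Let iM := sqlift_injM L.
Let piE := sqlift_val L.
Let sq := sqlift_sq L.

(* A lift [t] of [x] must satisfy [t e t^-1 = [t, e] e = <x, p e> e]. *)
Let alpha (e : E) := i (ucm x (p e)) * e.

Fact adjoin_data : ext2_data alpha (i (usq x)).
Proof.
split=> [e f||e]; rewrite /alpha.
- rewrite pM ucmMr iM -(sqlift_lconj L) /lconj.
  by rewrite !mulgA mulgVK.
- by rewrite piE uval_sq ucm_exp2 (morph1 iM) mul1g.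
(* The two factors combine by [ucmMl] into $\langle x^2,pe\rangle$, the commutator of [i (usq x)]
   and [e]. *)
rewrite pM piE uval_cm -lconj_lcomm mulgA -iM.
have /= := ucmMl x x (p e); rewrite lconj_id => <-.
by rewrite lconj_lcomm (sqlift_comm L) piE uval_sq.
Qed.

Lemma square_lift_adjoin :
  exists (E' : groupType) (p' : E' -> G) (i' : ucover G -> E'),
    [/\ square_lift p' i', forall e, exists e', p' e' = p e
      & exists e, p' e = x].
Proof.
pose p' (e : ext2 adjoin_data) : G := p e.1 * (if e.2 then x else 1).
pose i' u : ext2 adjoin_data := (i u, false).
exists (ext2 adjoin_data), p', i'; split; last 2 first.
- by move=> e; exists (e, false); rewrite /p' mulg1.
- by exists (1, true); rewrite /p' (morph1 pM) mul1g.
split.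
- move=> [e []] [f []]; rewrite /p' ext2_mulE /ext2_mul /= !pM;
  rewrite ?(morph1 pM) ?mulg1 ?mulgA //.
    by rewrite !piE uval_cm uval_sq !mulgA /lcomm !mulgVK.
  by rewrite piE uval_cm /lcomm !mulgA !mulgVK.
- by move=> u v; rewrite /i' ext2_mulE /ext2_mul /= iM mulg1.
- by move=> u v [/(sqlift_inj L)].
- by move=> u; rewrite /p' /i' /= mulg1 piE.
move=> [e []]; rewrite ext2_mulE /ext2_mul /i' /p' /=; congr (_, _).
  (* The square of $et$ is $e\langle x,pe\rangle e(x)$, and [usqM] expands [usq (p e * x)] to the
     same product. *)
  rewrite usqM !iM -{2}[p e]lconj_id -(sqlift_lconj L) -sq.
  by rewrite /alpha /lconj !mulgA mulgVK.
by rewrite !mulg1 sq.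
Qed.
End AdjoinElement.

Lemma square_lift_cover (G : finGroupType) :
  exists (E : groupType) (p : E -> G) (i : ucover G -> E),
    square_lift p i /\ forall x, exists e, p e = x.
Proof.
(* Induction on a bound for the number of elements of [G] missed by [p]; finiteness of [G] makes the
   tower stop. *)
suff H n (E : groupType) (p : E -> G) (i : ucover G -> E) :
    square_lift p i -> (#|[pred x | ~~ `[< exists e, p e = x >]]| <= n)%N ->
    exists (E : groupType) (p : E -> G) (i : ucover G -> E),
      square_lift p i /\ forall x, exists e, p e = x.
  exact: (H _ _ _ _ (@ucover_square_lift G) (leqnn _)).
elim: n E p i => [|n IHn] E p i L pn;
  (have [pS|/existsNP[x px]] := pselect (forall x, exists e, p e = x);
    first by exists E, p, i).
  by move: pn; rewrite leqn0 => /eqP/card0_eq/(_ x)/negbFE/asboolP/px.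
have [E' [p' [i' [L' pp' [e' px']]]]] := square_lift_adjoin x L.
apply: (IHn E' p' i' L'); rewrite -ltnS (leq_trans _ pn) //.
apply/proper_card/properP; split.
  apply/fintype.subsetP => y; rewrite !inE; apply: contra => /asboolP [e <-].
  exact/asboolP/pp'.
exists x; first exact/asboolPn.
by rewrite inE negbK; apply/asboolP; exists e'.
Qed.

(** * The quotient of $F$ by $[F,R]R^2$ and morphisms out of $F$ *)

Section HopfFormula.
Variables (F : groupType) (R : normalClosed F).

Local Notation M := (prodsub (commsub R) (sqsub R)).

Lemma comm_hopf f r : r \in R -> lcomm f r \in M.
Proof.
move=> Rr; apply/asboolP; exists (lcomm f r), 1; rewrite gpred1 mulg1.
by split=> //; apply: sub_gensub; exists f, r.
Qed.

Lemma sq_hopf r : r \in R -> r * r \in M.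
Proof.
move=> Rr; apply/asboolP; exists 1, (r * r); rewrite gpred1 mul1g.
by split=> //; apply: sub_sqsub.
Qed.

Lemma morph_hopf (E : groupType) (h : F -> E) : {morph h : x y / x * y} ->
  (forall f r, r \in R -> lcomm (h f) (h r) = 1) ->
  (forall r, r \in R -> h r * h r = 1) ->
  forall w, w \in M -> h w = 1.
Proof.
move=> hM hC hS _ /asboolP [a [b [Ha Hb ->]]]; rewrite hM.
have P1 := morph1 hM.
have PM x y : h x = 1 -> h y = 1 -> h (x * y) = 1.
  by rewrite hM => -> ->; rewrite mulg1.
have PV x : h x = 1 -> h x^-1 = 1.
  by rewrite (morphV hM) => ->; rewrite invg1.
rewrite (gensub_ind P1 PM PV _ Ha) ?mul1g.
  apply: (gensub_ind P1 PM PV _ Hb) => _ [r Rr <-].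
  by rewrite hM hS.
by move=> _ [f [r Rr ->]]; rewrite (morph_lcomm hM) hC.
Qed.

Local Notation pi := (\pi_(quotg M)).
Let piM := @pi_quotgM _ M.

Lemma pi_hopf_eq1 w : pi w = 1 <-> w \in M.
Proof.
have -> : 1 = pi 1 by [].
split=> [/esym/quotg_eqE|h]; first by rewrite invg1 mul1g.
by apply/esym/quotg_eqE; rewrite invg1 mul1g.
Qed.

Lemma pi_comm_hopf f r : r \in R -> commute (pi f) (pi r).
Proof.
move=> /(comm_hopf f)/pi_hopf_eq1; rewrite (morph_lcomm piM) /lcomm => h.
by apply: (mulIg (pi f)^-1); apply: (mulIg (pi r)^-1); rewrite h mulgK mulgV.
Qed.

(** Modulo $[F,R]R^2$ an element of $R$ is central with trivial square, so it drops out of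
    $(fr)^2$. *)
Lemma pi_sq_hopf f r : r \in R -> pi (f * r) * pi (f * r) = pi f * pi f.
Proof.
move=> Rr; have /pi_hopf_eq1 := sq_hopf Rr; rewrite !piM => r2.
by rewrite -mulgA (mulgA (pi r)) -(pi_comm_hopf f Rr) -mulgA r2 mulg1.
Qed.
End HopfFormula.

(* Freeness lifts [t] to a map into a square lift of [G]. *)
Lemma hopf_lift (G : finGroupType) (F : groupType) (R : normalClosed F)
    (t : F -> G) :
  is_free F -> {morph t : x y / x * y} -> (forall r, r \in R -> t r = 1) ->
  exists (E : groupType) (lam : F -> E) (i : ucover G -> E),
    [/\ {morph lam : x y / x * y}, {morph i : x y / x * y}, injective i,
        forall w, w \in prodsub (commsub R) (sqsub R) -> lam w = 1 &
        forall a, lam (a * a) = i (usq (t a))].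
Proof.
move=> [X [rho rhoM [rhoV rhoK rhoVK]]] tM tR.
have [E [p [i [L pS]]]] := square_lift_cover G.
have rhoVM : {morph rhoV : x y / x * y}.
  by move=> x y; rewrite -[x]rhoVK -[y]rhoVK -rhoM !rhoK.
(* Lifts to [E] of the images of the free generators; they determine [lam]. *)
have [e eE] := choice (fun x => pS (t (rho (fgen x)))).
pose lam (x : F) : E := free_lift e (rhoV x).
have lamM : {morph lam : x y / x * y}.
  by move=> x y; rewrite /lam rhoVM free_liftM.
have p_lam x : p (lam x) = t x.
  rewrite -[x in RHS]rhoVK /lam; move: (rhoV x) => {}x; move: x.
  apply: free_hom_eq => [x y|x y|x].
  - by rewrite free_liftM (sqliftM L).
  - by rewrite rhoM tM.
  - by rewrite free_lift_gen eE.
have i1 := morph1 (sqlift_injM L).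
exists E, lam, i; split=> //; [exact: (sqlift_injM L)|exact: (sqlift_inj L)| |].
  apply: (morph_hopf lamM) => [a r /tR tr|r /tR tr].
    by rewrite (sqlift_comm L) !p_lam tr ucmg1 i1.
  by rewrite (sqlift_sq L) p_lam tr usq1 i1.
by move=> a; rewrite lamM (sqlift_sq L) p_lam.
Qed.

(** The value of [phi] on a symbol can be read off any lifts of its entries, so on suitable lifts
    each relation becomes an identity in $F$. *)
Lemma urelation_lift (G F Q : groupType) (t : F -> G) (h : F -> Q)
    (phi : ugroup G -> Q) :
  {morph t : x y / x * y} -> {morph h : x y / x * y} ->
  {morph phi : x y / x * y} -> (forall x, exists f, t f = x) ->
  (forall f g, phi (uC (t f) (t g)) = h (lcomm f g)) ->
  (forall f g, phi (uB (t f) (t g)) = h (lbrace f g)) ->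
  (forall f, phi (uQ (t f)) = h (f * f)) ->
  forall u v, urelation u v -> phi u = phi v.
Proof.
move=> tM hM phiM tS phiC phiB phiQ u v.
have [tJ tC] := (morph_lconj tM, morph_lcomm tM).
have [tB tV] := (morph_lbrace tM, morphV tM).
case=> [x i j|x y|x y|x y z|x y z|x y z|x y z|x y z|b x y|a x y].
  have [f <-] := tS x; rewrite phiM -!(morph_zexp tM) !phiQ -hM; congr h.
  have ab : commute (zexp f i) (zexp f j).
    by rewrite /commute -!zexpD GRing.addrC.
  by rewrite zexpD !mulgA -(mulgA _ (zexp f j) (zexp f i)) -ab !mulgA.
1,2: have [f <-] := tS x; have [g <-] := tS y.
3-7: have [f <-] := tS x; have [g <-] := tS y; have [k <-] := tS z.
8: have [f <-] := tS x; have [g <-] := tS y; have [k <-] := tS b.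
9: have [f <-] := tS x; have [g <-] := tS y; have [k <-] := tS a.
all: rewrite ?expg2 /uJ /= -/(uC _ _) -/(uB _ _) -?tC -?tB.
all: rewrite -?tV -?tM -?tV -?tJ.
all: rewrite ?(morphV phiM) ?phiM ?phiC ?phiB ?phiQ -?(morphV hM) -?hM.
all: congr h.
all: rewrite /lcomm /lbrace /lconj ?invgM ?invgK ?mulgA.
all: by rewrite ?(mulgVK, mulgK, mulgV, mulVg, mul1g).
Qed.

(** * The Hopf formula isomorphism *)

Theorem mainTheorem1 (G : finGroupType) (F : groupType) (R : normalClosed F)
    (F_free : is_free F) (G_pres : isog_group G (quotg R)) :
  isog_group (unoriented_schur G)
    (subquot (capsub R (sqsub predT)) (prodsub (commsub R) (sqsub R))).
Proof.
have [f fM [g fK gK]] := G_pres.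
have gM : {morph g : x y / x * y}.
  by move=> x y; rewrite -[x]gK -[y]gK -fM !fK.
pose t (w : F) : G := g (\pi_(quotg R) w).
have tM : {morph t : x y / x * y} by move=> x y; rewrite /t pi_quotgM gM.
have tR w : (t w == 1) = (w \in R).
  rewrite -(morph1 tM) (can_eq gK) eq_sym; apply/eqP/idP => [/quotg_eqE|wR].
    by rewrite invg1 mul1g.
  by apply/quotg_eqE; rewrite invg1 mul1g.
pose s (x : G) : F := repr (f x).
have sK : cancel s t by move=> x; rewrite /t reprK fK.
pose M := prodsub (commsub R) (sqsub R).
pose pi := \pi_(quotg M).
have piM : {morph pi : x y / x * y} by exact: pi_quotgM.
(* Modulo [M], squares depend only on images in [G], and so do the commutators and braces built from
   them; hence the choice of the section [s] is harmless. *)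
have sqE a b : t a = t b -> pi (a * a) = pi (b * b).
  move=> ab; rewrite !piM -(mulKVg b a) pi_sq_hopf // -tR tM (morphV tM) ab.
  by rewrite mulVg.
have mulE a b c d : pi a = pi c -> pi b = pi d -> pi (a * b) = pi (c * d).
  by rewrite !piM => -> ->.
have commE a b c d : t a = t c -> t b = t d -> pi (lcomm a b) = pi (lcomm c d).
  move=> ac bd; rewrite !lcomm_sq.
  by apply: (mulE); [apply: (mulE)|]; apply: sqE;
    rewrite // ?tM !(morphV tM) ?ac bd.
have braceE a b c d :
    t a = t c -> t b = t d -> pi (lbrace a b) = pi (lbrace c d).
  move=> ac bd; rewrite !lbrace_sq.
  by apply: mulE; apply: sqE; rewrite // !tM !(morphV tM) ac bd.
pose lift_symbol (c : usymbol G) : F := match c with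
  | Ucomm x y => lcomm (s x) (s y)
  | Ubrace x y => lbrace (s x) (s y)
  | Usq z => s z * s z end.
pose phi : ugroup G -> F := free_lift lift_symbol.
have phiM : {morph phi : x y / x * y} by exact: free_liftM.
have phi_gen c : phi (fgen c) = lift_symbol c by exact: free_lift_gen.
have t_phi w : t (phi w) = ueval w.
  move: w; apply: free_hom_eq => [x y|x y|c]; rewrite ?phiM ?tM ?uevalM //.
  rewrite phi_gen [ueval _]free_lift_gen.
  by case: c => [x y|x y|z] /=;
    rewrite ?(morph_lcomm tM) ?(morph_lbrace tM) ?tM ?sK.
have phi_sq w : phi w \in sqsub predT.
  have [l ->] := freegrpP w; elim: l => [|[c b] l IHl].
    by rewrite (morph1 phiM) gpred1.
  have cS : phi (fgen c) \in sqsub predT.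
    rewrite phi_gen; case: c => [x y|x y|z] /=.
    - exact: lcomm_sqsub.
    - exact: lbrace_sqsub.
    - exact: sub_sqsub.
  rewrite -cat1s -freegrpM phiM gpredM //; case: b => //.
  by rewrite fgenV (morphV phiM) gpredV.
have phi_ker w : (w \in urelators G) -> phi w \in M.
  (* This is [pi \o phi] rewritten as a [free_lift], whose kernel is a normal subgroup by instance;
     $N'$ is the least one containing the relators. *)
  pose pphi := free_lift (fun c => pi (lift_symbol c)).
  have pphiE : pphi =1 pi \o phi.
    apply: free_hom_eq => [x y|x y|c] /=; first exact: free_liftM.
      by rewrite phiM piM.
    by rewrite phi_gen [LHS]free_lift_gen.
  have kE v : (v \in kersub pphi) = (pi (phi v) == 1) by rewrite inE pphiE.
  move=> /asboolP /(_ (kersub pphi)); rewrite kE => h.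
  apply/pi_hopf_eq1/eqP; apply: h => _ [u [v [uv ->]]] /=.
  rewrite kE phiM piM (morphV phiM) (morphV piM).
  suff -> : pi (phi u) = pi (phi v) by rewrite mulgV.
  apply: (@urelation_lift G F (quotg M) t pi (pi \o phi) tM piM) uv.
  - by move=> x y /=; rewrite phiM piM.
  - by move=> x; exists (s x).
  - by move=> a b /=; rewrite phi_gen; apply: commE; rewrite sK.
  - by move=> a b /=; rewrite phi_gen; apply: braceE; rewrite sK.
  - by move=> a /=; rewrite phi_gen /=; apply: sqE; rewrite sK.
have phi_inj w : phi w \in M -> w \in urelators G.
  have tR1 r : r \in R -> t r = 1 by rewrite -tR => /eqP.
  have [E [lam [i [lamM iM i_inj lam1 lamE]]]] := hopf_lift F_free tM tR1.
  have iV := morphV iM; have tV := morphV tM.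
  (* Both sides are morphisms on the free group, compared on symbols; injectivity of [i] then puts
     [w] in $N'$. *)
  move/lam1; have -> : lam (phi w) = i (\pi_(quotg (urelators G)) w).
    move: w; apply: free_hom_eq => [x y|x y|c].
    - by rewrite phiM lamM.
    - by rewrite pi_quotgM iM.
    rewrite phi_gen; case: c => [x y|x y|z] /=.
    - by rewrite lcomm_sq lamM (lamM (s x * s x)) !lamE !tM !tV !sK -!iM -ucmE.
    - by rewrite lbrace_sq (lamM (s x * s x)) !lamE tM tV !sK -iM -pi_uB.
    - by rewrite lamE sK.
  rewrite -(morph1 iM) => /i_inj/esym/quotg_eqE.
  by rewrite invg1 mul1g.
apply: (subquot_isog phiM) => [w wK|w _|l].
- by rewrite inE phi_sq andbT -tR t_phi.
- by apply/idP/idP; [exact: phi_ker | exact: phi_inj].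
rewrite inE => /andP[lR lS].
(* As [M] lies in $R$, such a [w] satisfies [t (phi w) = 1] and so is in $K'$. *)
suff [w wl] : exists w, pi (phi w) = pi l.
  have wl' : (phi w)^-1 * l \in M by apply/quotg_eqE.
  exists w => //; rewrite inE -t_phi tR.
  have /hopf_sub := wl'; rewrite inE => /andP[wlR _].
  by rewrite -gpredV -(mulgK l (phi w)^-1) gpredM ?gpredV.
(* The claim is proved on all of $S(F)$, where induction applies: a generator $a^2$ comes from the
   symbol $(t\,a)$. *)
move: l lS {lR}; pose P l := exists w, pi (phi w) = pi l.
apply: (@gensub_ind F _ P).
- by exists 1; rewrite (morph1 phiM).
- by move=> a b [u ua] [v vb]; exists (u * v); rewrite phiM; apply: mulE.
- by move=> a [u ua]; exists u^-1; rewrite (morphV phiM) !(morphV piM) ua.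
- move=> _ [a _ <-]; exists (uQ (t a)); rewrite phi_gen.
  by apply: sqE; rewrite sK.
Qed.
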